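(* Let $S\subseteq\mathbb{Z}[x]$ be finite. Then the set $F(S)$ of determinants attained by the forbidden minors for $S$ is finite, and $$\max_{f\in F(S)}|f|\le 2\cdot\max_{s\in S}s^2,$$ i.e. $|f|\le 2\cdot\max_{s\in S}s^2$ for every $f\in F(S)$.
   Context: $\mathbb{Z}[x]$ is the ring of polynomials in one indeterminate $x$ with integer coefficients. It is totally ordered by: $s<t$ if and only if the leading coefficient of $t-s$ is positive. All maxima and inequalities are with respect to this order, and $|s|=s$ if $s\ge 0$, $|s|=-s$ otherwise. For $S\subseteq\mathbb{Z}[x]$, a matrix $M\in\mathbb{Z}[x]^{m\times n}$ (with $m,n\ge 1$) is totally $S$-modular if for every $1\le k\le\min\{m,n\}$ the determinant of every $k\times k$ submatrix of $M$ lies in $S$. For $l\ge 2$, a matrix $M\in\mathbb{Z}[x]^{l\times l}$ is a forbidden minor for $S$ if every $(l-1)\times(l-1)$ submatrix of $M$ is totally $S$-modular but $\det M\notin S$. $F(S)\subseteq\mathbb{Z}[x]$ denotes the set of all polynomials that arise as the determinant of some forbidden minor for $S$ (of any size $l\ge 2$). *)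

(* Defs.v *)
(* MathComp world; [classical_sets] is used for possibly infinite sets. *)
From HB Require Import structures.
From mathcomp Require Import all_boot all_order all_algebra.
From mathcomp Require Import finmap.
From mathcomp Require Import boolp classical_sets functions cardinality.

Set Implicit Arguments.
Unset Strict Implicit.
Unset Printing Implicit Defensive.

Import Order.TTheory GRing.Theory Num.Theory.

Local Open Scope ring_scope.

(* A copy of [{poly int}] carrying the total order below; the ring structure
   is the usual one. *)
Definition Zx : Type := {poly int}.

HB.instance Definition _ := GRing.IntegralDomain.on Zx.

Definition Zx_lt (s t : Zx) : bool := 0 < lead_coef (t - s : {poly int}).
Definition Zx_le (s t : Zx) : bool := (s == t) || Zx_lt s t.
Definition Zx_abs (s : Zx) : Zx := if Zx_le 0 s then s else - s.

Fact Zx_lt0_add (x y : Zx) : Zx_lt 0 x -> Zx_lt 0 y -> Zx_lt 0 (x + y).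
Proof.
rewrite /Zx_lt !subr0 => x0 y0.
case: (ltngtP (size (x : {poly int})) (size (y : {poly int}))) => [lt|lt|e].
- by rewrite lead_coefDr.
- by rewrite lead_coefDl.
have xy0 : 0 < ((x : {poly int}) + y)`_(size (x : {poly int})).-1.
  by rewrite coefD addr_gt0 // [in X in _ < X]e.
have sz : size ((x : {poly int}) + y) = size (x : {poly int}).
  apply/eqP; rewrite eqn_leq (leq_trans (size_polyD _ _)) ?e ?maxnn //=.
  have sx : (0 < size (x : {poly int}))%N.
    by rewrite size_poly_gt0 -lead_coef_eq0 gt_eqF.
  rewrite -e leqNgt; apply/negP => lt; move: xy0.
  by rewrite nth_default ?ltxx // -ltnS prednK.
by rewrite /lead_coef sz.
Qed.

Fact Zx_lt0_mul (x y : Zx) : Zx_lt 0 x -> Zx_lt 0 y -> Zx_lt 0 (x * y).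
Proof.
by rewrite /Zx_lt !subr0 => x0 y0; rewrite lead_coefM mulr_gt0.
Qed.

Fact Zx_lt0_ngt0 (x : Zx) : Zx_lt 0 x -> ~~ Zx_lt x 0.
Proof.
by rewrite /Zx_lt subr0 sub0r lead_coefN oppr_gt0 => /ltW; rewrite leNgt.
Qed.

Fact Zx_sub_gt0 (x y : Zx) : Zx_lt 0 (y - x) = Zx_lt x y.
Proof. by rewrite /Zx_lt subr0. Qed.

Fact Zx_lt0_total (x : Zx) : x != 0 -> Zx_lt 0 x || Zx_lt x 0.
Proof.
rewrite /Zx_lt subr0 sub0r lead_coefN oppr_gt0 -lead_coef_eq0.
by case: ltgtP.
Qed.

Fact Zx_absN (x : Zx) : Zx_abs (- x) = Zx_abs x.
Proof.
have [->|x0] := eqVneq x 0; first by rewrite oppr0.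
rewrite /Zx_abs /Zx_le !(eq_sym 0) oppr_eq0 (negPf x0) /=.
have -> : Zx_lt 0 (- x) = Zx_lt x 0 by rewrite /Zx_lt subr0 sub0r.
case: (boolP (Zx_lt x 0)) (Zx_lt0_total x0) (@Zx_lt0_ngt0 x) => [_ _|_].
  by case: (Zx_lt 0 x) => // /(_ isT).
by rewrite orbF opprK => ->.
Qed.

Fact Zx_ge0_abs (x : Zx) : Zx_le 0 x -> Zx_abs x = x.
Proof. by rewrite /Zx_abs => ->. Qed.

(* Makes [<], [<=], [Num.max] and [`|_|] on [Zx] the ones of [Zx_lt],
   [Zx_le] and [Zx_abs]. *)
HB.instance Definition _ := Num.IntegralDomain_isLtReal.Build Zx
  Zx_lt0_add Zx_lt0_mul Zx_lt0_ngt0 Zx_sub_gt0 Zx_lt0_total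
  Zx_absN Zx_ge0_abs (fun _ _ => erefl).

(* Strictly increasing choice of rows (or columns): submatrices keep the
   original ordering, so that their determinants have a definite sign. *)
Definition increasing (k n : nat) (f : 'I_k -> 'I_n) : Prop :=
  forall i j : 'I_k, (i < j)%N -> (f i < f j)%N.

Definition totally_modular (S : set Zx) (m n : nat) (M : 'M[Zx]_(m, n)) :
    Prop :=
  forall k : nat, (1 <= k <= minn m n)%N ->
  forall (f : 'I_k -> 'I_m) (g : 'I_k -> 'I_n), increasing f -> increasing g ->
  S (\det (mxsub f g M)).

Definition forbidden_minor (S : set Zx) (l : nat) (M : 'M[Zx]_l) : Prop :=
  [/\ (2 <= l)%N,
      forall f g : 'I_l.-1 -> 'I_l, increasing f -> increasing g ->
        totally_modular S (mxsub f g M)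
    & ~ S (\det M)].

Definition forbidden_dets (S : set Zx) : set Zx :=
  [set d : Zx | exists (l : nat) (M : 'M[Zx]_l),
    forbidden_minor S M /\ \det M = d]%classic.

(* Squares are nonnegative, so the default value 0 does not affect the maximum
   over a nonempty finite [S]; if [S] is empty then so is
   [forbidden_dets S]. *)
Definition max_sqr (S : set Zx) : Zx :=
  \big[Num.max/0]_(s <- fset_set S) s ^+ 2.

(* Main.v *)
(** Let [M] be a forbidden minor with nonzero determinant. Expanding twice along
    the first row gives a nonzero minor [D] of order [l - 2], and the
    Desnanot-Jacobi identity writes [\det M * D] as [a b - c d], up to sign,
    where [a, b, c, d] are minors of order [l - 1], hence elements of [S].
    As [D] is in [S] or is the empty minor 1, only finitely many quotients
    arise, and the bound follows from [1 <= `|D|]. *)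
Require Import Defs.
From mathcomp Require Import all_boot all_order all_fingroup all_algebra.
From mathcomp Require Import finmap.
From mathcomp Require Import boolp classical_sets functions cardinality.
From mathcomp Require Import zify ring.

Import Order.TTheory GRing.Theory Num.Theory.
Local Open Scope ring_scope.

(** Subtracting 1 keeps the leading coefficient of a nonconstant polynomial, and constants compare
    as integers. *)
Lemma Zx_gt0_ge1 (y : Zx) : 0 < y -> 1 <= y.
Proof.
rewrite -[_ < _]/(Zx_lt 0 y) /Zx_lt subr0 => y_gt0.
rewrite -[_ <= _]/(Zx_le 1 y) /Zx_le /Zx_lt.
have [sz|sz] := leqP (size (y : {poly int})) 1.
  have yE := size1_polyC sz; move: (nth 0 _ 0) yE => c yE; move: y_gt0.
  rewrite {}yE lead_coefC => c_gt0.
  rewrite -[(1 : Zx)]/(1%:P : {poly int}) -polyCB lead_coefC subr_gt0.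
  by rewrite (inj_eq (@polyC_inj _)); lia.
by rewrite (lead_coefDl (p := y)) ?y_gt0 ?orbT // size_polyN size_poly1.
Qed.

Lemma Zx_norm_ge1 (y : Zx) : y != 0 -> 1 <= `|y|.
Proof. by move=> y0; apply: Zx_gt0_ge1; rewrite normr_gt0. Qed.

Lemma increasing_lift {n} (j : 'I_n.+1) : increasing (lift j).
Proof. by move=> a b; rewrite /= /bump; lia. Qed.

Lemma row'_col'E {R : Type} {m n} i j (M : 'M[R]_(m.+1, n.+1)) :
  row' i (col' j M) = mxsub (lift i) (lift j) M.
Proof. by apply/matrixP => a b; rewrite !mxE. Qed.

Lemma det_row'_col'_neq0 {R : comNzRingType} {n}
    (M : 'M[R]_n.+1) (i : 'I_n.+1) :
  \det M != 0 -> exists j, \det (row' i (col' j M)) != 0.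
Proof.
move=> dM; apply/existsP; apply: contraNT dM => /existsPn D0.
rewrite (expand_det_row M i) big1 // => j _.
by rewrite /cofactor (eqP (negPn (D0 j))) !mulr0.
Qed.

Lemma det_mx22 {R : comPzRingType} (A : 'M[R]_2) :
  \det A = A 0 0 * A 1 1 - A 0 1 * A 1 0.
Proof.
rewrite (expand_det_row A 0) !big_ord_recl big_ord0 addr0 /cofactor !det_mx11.
rewrite !mxE /= expr0 mul1r expr1 mulN1r mulrN.
by congr (A _ _ * A _ _ - A _ _ * A _ _); apply: val_inj.
Qed.

(** The left side is a 2 by 2 minor of the adjugate, so this is Jacobi's complementary minor
    identity for rows 0, 1 and columns [j], [lift j j']. *)
Lemma desnanot_jacobi {R : idomainType} {n} (M : 'M[R]_n.+2)
    (j : 'I_n.+2) (j' : 'I_n.+1) : \det M != 0 ->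
  cofactor M 0 j * cofactor M 1 (lift j j')
    - cofactor M 1 j * cofactor M 0 (lift j j')
  = \det M * ((-1) ^+ (j + j') * \det (row' 0 (col' j' (row' 0 (col' j M))))).
Proof.
(* [s] lists columns [j] and [lift j j'] first and the others in their original order; its sign is
   [(-1) ^+ (j + j')]. *)
move=> dM; pose s : 'S_n.+2 := lift_perm 0 j (lift_perm 0 j' 1%g).
have s0 : s 0 = j by rewrite /s lift_perm_id.
have sS k : s (lift 0 (lift 0 k)) = lift j (lift j' k).
  by rewrite /s !lift_perm_lift perm1.
have lift01 : 1 = lift 0 0 :> 'I_n.+2 by apply: val_inj.
have s1 : s 1 = lift j j' by rewrite lift01 /s lift_perm_lift lift_perm_id.
pose A : 'M[R]_(2 + n) := col_perm s M.
pose B : 'M[R]_(2 + n) := row_perm s (\adj M).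
have AB : A *m B = (\det M)%:M.
  rewrite /A /B col_permE row_permE mulmxA -(mulmxA M) -perm_mxM mulVg perm_mx1.
  by rewrite mulmx1 mul_mx_adj.
have detA : \det A = (-1) ^+ (j + j') * \det M.
  rewrite /A col_permE det_mulmx det_perm mulrC odd_permV /s !odd_lift_perm.
  by rewrite odd_perm1 addbF !addFb -oddD signr_odd.
(* As [A *m B] is scalar, replacing the last [n] columns of [B] by those of the
   identity makes the product triangular; the claim compares determinants. *)
pose C : 'M[R]_(2 + n) := block_mx (ulsubmx B) 0 (dlsubmx B) 1%:M.
have AC : A *m C = block_mx (\det M)%:M (ursubmx A) 0 (drsubmx A).
  move: AB; rewrite -{1}(submxK A) -{1}(submxK B) mulmx_block scalar_mx_block.
  case/eq_block_mx => ul _ dl _.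
  by rewrite /C -{1}(submxK A) mulmx_block ul dl !mulmx0 !mulmx1 !add0r.
have := congr1 determinant AC.
rewrite det_mulmx det_lblock det_ublock det1 mulr1 det_scalar detA.
have -> : drsubmx A = row' 0 (col' j' (row' 0 (col' j M))).
  apply/matrixP => a b; rewrite !mxE.
  by rewrite -sS; congr (M _ (s _)); apply: val_inj.
have -> : \det (ulsubmx B) = cofactor M 0 j * cofactor M 1 (lift j j')
    - cofactor M 1 j * cofactor M 0 (lift j j').
  have l0 : lshift n 0 = 0 :> 'I_(2 + n) by apply: val_inj.
  have l1 : lshift n 1 = 1 :> 'I_(2 + n) by apply: val_inj.
  by rewrite det_mx22 !mxE !l0 !l1 s0 s1.
(* Both sides still carry a common factor [\det M], which is cancelled. *)
move: (_ - _) => Y; rewrite -mulrA => /(canRL (signrMK _)) E.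
by apply: (mulfI dM); rewrite E; ring.
Qed.

(** Cofactors are minors only up to sign; closing under negation absorbs the sign and preserves
    finiteness and squares. *)
Definition signed (S : set Zx) : set Zx := (S `|` -%R @` S)%classic.

Lemma signed_signM {S : set Zx} n {x : Zx} : S x -> signed S ((-1) ^+ n * x).
Proof.
rewrite -signr_odd; case: (odd n) => Sx; last by left; rewrite mul1r.
by right; exists x; rewrite //= mulN1r.
Qed.

Lemma finite_signed {S : set Zx} : finite_set S -> finite_set (signed S).
Proof. by move=> fS; rewrite finite_setU; split=> //; exact: finite_image. Qed.

Lemma signed_sqr_le {S : set Zx} {x : Zx} :
  finite_set S -> signed S x -> x ^+ 2 <= max_sqr S.
Proof.
move=> fS; have Sle y : S y -> y ^+ 2 <= max_sqr S.
  move=> Sy; apply: (@le_bigmax_seq _ Zx _ _ 0 y xpredT (fun s => s ^+ 2)) => //.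
  by rewrite in_fset_set// inE.
by case=> [/Sle //|[y /Sle Sy <-]]; rewrite sqrrN.
Qed.

Lemma forbidden_minor_quotient {S : set Zx} {l} {M : 'M[Zx]_l} :
  forbidden_minor S M -> \det M != 0 ->
  exists a b c d u : Zx,
    [/\ [/\ signed S a, signed S b, signed S c & signed S d],
        signed (1 |` S)%classic u, u != 0 & a * b - c * d = \det M * u].
Proof.
case: l M => [|[|n]] M [// _ tM _] dM.
have minorS i j : S (\det (row' i (col' j M))).
  (* The submatrix of order [l - 1] is its own full-size submatrix. *)
  rewrite row'_col'E -[mxsub _ _ _]mxsub_id.
  by apply: tM; rewrite ?minnn ?leqnn //; exact: increasing_lift.
have [j Dj] := det_row'_col'_neq0 M 0 dM.
have [j' Dj'] := det_row'_col'_neq0 _ 0 Dj.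
have := desnanot_jacobi M j j' dM; rewrite /cofactor => E.
do 5 eexists; split; last exact: E.
- by split; apply: signed_signM.
(* For [n = 0] the inner minor is the empty determinant, which is why 1 is adjoined to [S]. *)
- apply: signed_signM; clear -tM; case: n => [|n] in M tM j j' *.
    by left; rewrite det_mx00.
  right; rewrite !row'_col'E.
  apply: (tM _ _ (increasing_lift 0) (increasing_lift j) n.+1) => //.
  - by rewrite leq_min !leqnSn.
  - exact: increasing_lift.
- by rewrite mulf_neq0 // signr_eq0.
Qed.

(** The product is at most the square of the factor of larger absolute value. *)
Lemma normM_le_sqr {x y m : Zx} : x ^+ 2 <= m -> y ^+ 2 <= m -> `|x * y| <= m.
Proof.
move=> xm ym; rewrite normrM; case: (lerP `|x| `|y|) => [xy|/ltW xy].
  by rewrite (le_trans _ ym) // -real_normK ?num_real // expr2 ler_wpM2r.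
by rewrite (le_trans _ xm) // -real_normK ?num_real // expr2 ler_wpM2l.
Qed.

Theorem lemma2 (S : set Zx) (finS : finite_set S) :
  finite_set (forbidden_dets S) /\
  (forall f : Zx, forbidden_dets S f -> `|f| <= 2 * max_sqr S).
Proof.
split.
  pose T := signed S; pose U := signed (1 |` S)%classic.
  (* [q] is exact division by choice: for a nonzero divisor the quotient is unique, and 0 is the
     value where none exists. *)
  pose q (t : Zx * Zx * (Zx * Zx) * Zx) : Zx :=
    xget 0 [set z | t.1.1.1 * t.1.1.2 - t.1.2.1 * t.1.2.2 = z * t.2]%classic.
  have finT : finite_set T by exact: finite_signed.
  have finU : finite_set U.
    by apply: finite_signed; rewrite finite_setU; split.
  (* The point 0 accounts for singular forbidden minors. *)
  apply: (@sub_finite_set _ _ (0 |` q @` (T `*` T `*` (T `*` T) `*` U))%classic).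
    move=> _ [l [M [fM <-]]]; have [->|dM] := eqVneq (\det M) 0; first by left.
    right; have [a [b [c [d [u [[Ta Tb Tc Td] Uu u0 E]]]]]] :=
      forbidden_minor_quotient fM dM.
    exists (a, b, (c, d), u) => //; apply: xget_unique => //= z.
    by rewrite E => /(mulIf u0)/esym.
  rewrite finite_setU; split=> //; apply: finite_image.
  by do 3 apply: finite_setX => //.
move=> _ [l [M [fM <-]]]; have [->|dM] := eqVneq (\det M) 0.
  (* The maximum starts from 0, so it is nonnegative. *)
  rewrite normr0 mulr_ge0 //; exact: bigmax_ge_id.
have [a [b [c [d [u [[Ta Tb Tc Td] _ u0 E]]]]]] := forbidden_minor_quotient fM dM.
apply: (@le_trans _ _ `|\det M * u|).
  by rewrite normrM ler_peMr // Zx_norm_ge1.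
rewrite -E (le_trans (ler_normB _ _)) // mulr_natl mulr2n lerD //.
  by apply: normM_le_sqr; apply: signed_sqr_le.
by apply: normM_le_sqr; apply: signed_sqr_le.
Qed.
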